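(* Let $X$ be an abelian Polish group and let $A \subseteq X$ be Haar meager. Then $A$ is meager in $X$.
   Context: An abelian Polish group is an abelian topological group (written additively) whose topology is separable and completely metrizable. For $B\subseteq X$ and $x\in X$, $B+x=\{b+x : b\in B\}$. A subset of a topological space is meager in that space if it is a countable union of nowhere dense subsets of that space. A set $A\subseteq X$ is Haar meager if there exist a Borel set $B\subseteq X$ with $A\subseteq B$, a nonempty compact metric space $K$, and a continuous function $f:K\to X$ such that $f^{-1}(B+x)$ is meager in $K$ for every $x\in X$. *)

(* Defs.v *)
From HB Require Import structures.
From mathcomp Require Import all_boot all_order all_algebra.
From mathcomp Require Import all_classical all_reals all_analysis.

Set Implicit Arguments.
Unset Strict Implicit.
Unset Printing Implicit Defensive.

Import Order.TTheory GRing.Theory Num.Theory.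

Local Open Scope classical_set_scope.
Local Open Scope ring_scope.

Definition separable (T : topologicalType) : Prop :=
  exists2 D : set T, countable D & dense D.

Definition is_metric (R : realType) (T : Type) (d : T -> T -> R) : Prop :=
  [/\ forall x y, 0 <= d x y,
      forall x y, d x y = 0 <-> x = y,
      forall x y, d x y = d y x
    & forall x y z, d x z <= d x y + d y z].

Definition metric_cauchy (R : realType) (T : Type) (d : T -> T -> R)
    (u : nat -> T) : Prop :=
  forall e : R, 0 < e ->
    exists N : nat, forall m n : nat, (N <= m)%N -> (N <= n)%N ->
      d (u m) (u n) < e.

(* A bare distance function is quantified over, rather than a [metricType],
   because [metricType] carries its own topology, whereas here the metric has to
   induce the topology already given on [T].  The limits below are taken in that
   topology. *)
Definition completely_metrizable (R : realType) (T : topologicalType) : Prop :=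
  exists d : T -> T -> R,
    [/\ is_metric d,
        forall (x : T) (U : set T),
          nbhs x U <-> (exists2 e : R, 0 < e & [set y | d x y < e] `<=` U)
      & forall u : nat -> T, metric_cauchy d u ->
          exists l : T, u @ \oo --> l].

Definition polish (R : realType) (T : topologicalType) : Prop :=
  separable T /\ completely_metrizable R T.

Definition borel (T : topologicalType) (B : set T) : Prop :=
  <<s [set U : set T | open U] >> B.

Definition nowhere_dense (T : topologicalType) (A : set T) : Prop :=
  interior (closure A) = set0.

(* Finite unions are covered, since [set0] is nowhere dense. *)
Definition meager (T : topologicalType) (A : set T) : Prop :=
  exists2 F : nat -> set T,
    (forall n, nowhere_dense (F n)) & A = \bigcup_n F n.

Definition translate (X : zmodType) (B : set X) (x : X) : set X :=
  [set b + x | b in B].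

Definition haar_meager (R : realType) (X : topologicalZmodType) (A : set X)
    : Prop :=
  exists2 B : set X, borel B /\ A `<=` B &
    exists (K : metricType R) (f : K -> X),
      [/\ [set: K] !=set0,
          compact [set: K],
          continuous f
        & forall x : X, meager (f @^-1` translate B x)].

(* Main.v *)
From HB Require Import structures.
Require Import Defs.
From mathcomp Require Import all_boot all_order all_algebra.
From mathcomp Require Import all_classical all_reals all_analysis.

(** A Borel hull [B] of the Haar meager set has the Baire property: it agrees
    with an open set [U] up to meager sets.  If [U] is empty then [B] is meager
    and nothing is left to prove.  Otherwise write [U `\` B] as a union of
    nowhere dense sets [G n], and let [f : K -> X] witness Haar meagerness.

    The only obstacle is to find one translation [x] for which [f] pulls
    [B + x] back to a nonmeager set.  Since [K] is compact metric it has a dense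
    sequence [v], and countably many conditions on [x] suffice: if [f (v m) - x]
    avoids the closure of [G n] for every [m], then [f k - x] belongs to that
    closure only for [k] in a closed set that misses a dense set, hence in a
    nowhere dense set.  For fixed [m] and [n] the condition fails only on a
    nowhere dense set of [x], because [x |-> f (v m) - x] is a homeomorphism.
    So the Baire category theorem in [X] gives an [x] that satisfies all the
    conditions and also [f k0 - x \in U] for a chosen point [k0] of [K].  This
    choice of [x] along a dense sequence replaces the Kuratowski-Ulam theorem
    for [K * X].

    For that [x] the set of [k] with [f k - x \in U] is open and contains [k0],
    and it is covered by the preimage of [B + x], meager by assumption, and
    countably many nowhere dense sets.  This contradicts the Baire category
    theorem in [K] ([nonmeager_point] serves both spaces, by
    [compact_completely_metrizable]). *)

Set Implicit Arguments.
Unset Strict Implicit.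
Unset Printing Implicit Defensive.

Import Order.TTheory GRing.Theory Num.Theory.

Local Open Scope classical_set_scope.
Local Open Scope ring_scope.

(** * Nowhere dense and meager sets *)

Section Meager.
Context {T : topologicalType}.
Implicit Types A B U : set T.

Lemma nowhere_denseS A B : A `<=` B -> nowhere_dense B -> nowhere_dense A.
Proof.
by move=> AB nB; rewrite /nowhere_dense -subset0 -nB;
  apply/interiorS/closureS.
Qed.

Lemma nowhere_dense_closure A : nowhere_dense A -> nowhere_dense (closure A).
Proof.
by rewrite /nowhere_dense -[closure (closure A)](closure_id _).1//;
  exact: closed_closure.
Qed.

Lemma nowhere_dense0 : nowhere_dense (@set0 T).
Proof. by rewrite /nowhere_dense closure0 interior0. Qed.

Lemma meagerS A B : A `<=` B -> meager B -> meager A.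
Proof.
move=> AB [F nF BF]; exists (fun n => A `&` F n).
  by move=> n; apply: nowhere_denseS (nF n); exact: subIsetr.
by rewrite -setI_bigcupr -BF; apply/esym/setIidl.
Qed.

Lemma meager_nowhere_dense A : nowhere_dense A -> meager A.
Proof.
by move=> nA; exists (fun=> A) => //; rewrite bigcup_const //; exists 0%N.
Qed.

Lemma meager_bigcup (F : nat -> set T) :
  (forall n, meager (F n)) -> meager (\bigcup_n F n).
Proof.
move=> mF.
have /choice[G GP] n : exists G : nat -> set T,
    (forall m, nowhere_dense (G m)) /\ F n = \bigcup_m G m.
  by have [G nG FG] := mF n; exists G.
exists (fun k => if unpickle k is Some p then G p.1 p.2 else set0).
  move=> k; case: unpickle => [p|]; last exact: nowhere_dense0.
  by have [+ _] := GP p.1; exact.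
apply/seteqP; split => x [].
  move=> n _; have [_ ->] := GP n => -[m _ Gx].
  by exists (pickle (n, m)) => //; rewrite pickleK.
move=> k _; case: unpickle => [p Gx|//].
by exists p.1 => //; have [_ ->] := GP p.1; exists p.2.
Qed.

Lemma meagerU A B : meager A -> meager B -> meager (A `|` B).
Proof.
by move=> mA mB; rewrite -bigcup2E; apply: meager_bigcup => -[|[|n]] //=;
  exact/meager_nowhere_dense/nowhere_dense0.
Qed.

(** A nonempty open subset of [closure U] meets [U], so it cannot lie in
    [closure U `\` U]. *)
Lemma nowhere_dense_boundary U : open U -> nowhere_dense (closure U `\` U).
Proof.
move=> oU; rewrite /nowhere_dense -(closure_id _).1; last first.
  by apply: closedI; [exact: closed_closure|exact: open_closedC].
rewrite -subset0 => x Ix.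
have [clUx _] := interior_subset Ix.
have [y [Uy]] := clUx _ (open_nbhs_nbhs (conj (open_interior _) Ix)).
by move=> /interior_subset[].
Qed.

Lemma nowhere_dense_avoid_dense A D :
  closed A -> dense D -> A `&` D = set0 -> nowhere_dense A.
Proof.
move=> cA dD AD; rewrite /nowhere_dense -(closure_id _).1//.
apply: contrapT => /eqP/set0P I0.
have [x [Ax Dx]] := dD _ I0 (open_interior _).
by have : set0 x by rewrite -AD; split=> //; exact: interior_subset.
Qed.

End Meager.

(** An involution is its own inverse, so continuity alone makes it a
    homeomorphism; the maps [x |-> a - x] of an abelian group are of this kind. *)
Lemma nowhere_dense_preimage_involution (T : topologicalType) (g : T -> T)
    (A : set T) :
  continuous g -> involutive g -> nowhere_dense A -> nowhere_dense (g @^-1` A).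
Proof.
move=> cg gK nA; rewrite /nowhere_dense -subset0 => x Ix.
have : (closure A)° (g x).
  have nx : nbhs (g x) (g @^-1` (closure (g @^-1` A))).
    by apply: cg; rewrite gK.
  apply: filterS nx => y /= cly N yN.
  have [z [Az Nz]] : (g @^-1` A) `&` (g @^-1` N) !=set0.
    by apply: cly; apply: (cg (g y)); rewrite gK.
  by exists (g z).
by rewrite nA.
Qed.

(** * The Baire property of Borel sets *)

Definition baire_property (T : topologicalType) (B : set T) :=
  exists2 U : set T, open U & meager (B `\` U) /\ meager (U `\` B).

(** The complement of [B] is approximated by the exterior of [U]; the error grows
    only by the boundary of [U]. *)
Lemma baire_property_setC (T : topologicalType) (B : set T) :
  baire_property B -> baire_property (~` B).
Proof.
move=> [U oU [mBU mUB]]; exists (~` closure U).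
  by apply: closed_openC; exact: closed_closure.
split.
  apply: meagerS (meagerU mUB
    (meager_nowhere_dense (nowhere_dense_boundary oU))) => x [nBx].
  move=> /contrapT clx; have [Ux|nUx] := pselect (U x); first by left.
  by right.
apply: meagerS mBU => x [nclx /contrapT Bx]; split=> // Ux.
by apply: nclx; exact: subset_closure.
Qed.

Lemma baire_property_bigcup (T : topologicalType) (B : nat -> set T) :
  (forall n, baire_property (B n)) -> baire_property (\bigcup_n B n).
Proof.
move=> bB; have /choice[U UP] n : exists U : set T,
    open U /\ meager (B n `\` U) /\ meager (U `\` B n).
  by have [U oU mU] := bB n; exists U.
exists (\bigcup_n U n); first by apply: bigcup_open => n _; exact: (UP n).1.
split.
- apply: meagerS (meager_bigcup (fun n => (UP n).2.1)) => x [[n _ Bx] nUx].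
  by exists n => //; split=> // Ux; apply: nUx; exists n.
- apply: meagerS (meager_bigcup (fun n => (UP n).2.2)) => x [[n _ Ux] nBx].
  by exists n => //; split=> // Bx; apply: nBx; exists n.
Qed.

(** The sets with the Baire property form a sigma-algebra, and open sets are
    their own approximations. *)
Lemma borel_baire_property (T : topologicalType) (B : set T) :
  borel B -> baire_property B.
Proof.
have open_bp (U : set T) : open U -> baire_property U.
  move=> oU; exists U => //; rewrite setDv.
  by split; exact/meager_nowhere_dense/nowhere_dense0.
apply: smallest_sub => //; split.
- by apply: open_bp; exact: open0.
- by move=> A; rewrite setTD; exact: baire_property_setC.
- exact: baire_property_bigcup.
Qed.

(** * Baire category for completely metrizable spaces *)

(** The Baire category theorem, in the form in which it produces points: nested
    balls with radii tending to 0, the [n]th step leaving the closure of the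
    [n]th nowhere dense set, close in on a point by completeness. *)
Lemma nonmeager_point (R : realType) (T : topologicalType) (U M : set T) :
  completely_metrizable R T -> open U -> U !=set0 -> meager M ->
  exists2 x, U x & ~ M x.
Proof.
move=> [d [[d0 d1 dC dT] dn dc]] oU [x0 Ux0] [F nF ->].
(* From the ball [(x, r)] at stage [n], the next closed ball lies inside it and
   misses [closure (F n)]; the bound [1/(n+1)] makes the centres Cauchy. *)
have step (np : nat * (T * R)) : exists q : T * R, 0 < np.2.2 ->
    [/\ 0 < q.2, q.2 <= np.1.+1%:R^-1 &
      forall z, d q.1 z <= q.2 ->
        d np.2.1 z < np.2.2 /\ ~ closure (F np.1) z].
  move: np => [n [x r]] /=.
  have [r0|] := pselect (0 < r); last by exists (x, r).
  pose V := [set y | d x y < r].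
  have Vx : nbhs x V by apply/dn; exists r.
  have [y [Vy nFy]] : V `&` ~` closure (F n) !=set0.
    apply: contrapT => /set0P/negP/negPn/eqP V0.
    have : (closure (F n))° x.
      apply: filterS Vx => z Vz; apply: contrapT => nz.
      by have : set0 z by rewrite -V0.
    by rewrite nF.
  have [e e0 eV] : exists2 e, 0 < e &
      [set z | d y z < e] `<=` V `&` ~` closure (F n).
    apply/dn; apply: filterI; last first.
      apply: open_nbhs_nbhs; split=> //; apply: closed_openC.
      exact: closed_closure.
    apply/dn; exists (r - d x y); first by rewrite subr_gt0.
    move=> z /= yz; apply: le_lt_trans (dT x y z) _.
    by rewrite -ltrBrDl.
  exists (y, Num.min (e / 2) n.+1%:R^-1) => _ /=; split.
  - by rewrite lt_min divr_gt0//= invr_gt0 ltr0n.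
  - by rewrite ge_min lexx orbT.
  - move=> z; rewrite le_min => /andP[yz _].
    apply: eV => /=; apply: le_lt_trans yz _.
    by rewrite ltr_pdivrMr// ltr_pMr// ltr1n.
have [nxt nxtP] := choice step.
have [r0 r00 r0U] : exists2 e, 0 < e & [set y | d x0 y < e] `<=` U.
  by apply/dn; apply: open_nbhs_nbhs.
pose s := fix s n := if n is m.+1 then nxt (m, s m) else (x0, r0).
have s_gt0 n : 0 < (s n).2.
  by elim: n => //= n IH; have [] := nxtP (n, s n) IH.
have sP n := nxtP (n, s n) (s_gt0 n).
have dxx x : d x x = 0 by apply/d1.
have nest n k z : d (s (n + k)%N).1 z < (s (n + k)%N).2 -> d (s n).1 z < (s n).2.
  elim: k => [|k IH]; rewrite ?addn0// addnS => h; apply: IH.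
  by have [_ _ /(_ z (ltW h))[]] := sP (n + k)%N.
have near_s n m : (n <= m)%N -> d (s n).1 (s m).1 < (s n).2.
  by move=> /subnKC <-; apply: (nest _ (m - n)%N); rewrite dxx.
have [l ul] : exists l : T, (fun n => (s n).1 : T) @ \oo --> l.
  apply: dc => e e0.
  have [k] : exists k, 0 + k.+1%:R^-1 < e / 2.
    by apply: ltr_add_invr; rewrite divr_gt0.
  rewrite add0r => ke; exists k.+1 => m n km kn.
  rewrite (splitr e); apply: le_lt_trans (dT _ (s k.+1).1 _) _.
  have [_ sk _] := sP k.
  by apply: ltrD; first rewrite dC; apply: lt_le_trans (near_s _ _ _) _ => //;
    apply: le_trans sk (ltW ke).
have sl n : d (s n).1 l <= (s n).2.
  apply/ler_addgt0Pl => e e0.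
  have /ul[N _ NP] : nbhs l [set y | d l y < e] by apply/dn; exists e.
  have /= := NP (maxn N n) (leq_maxl _ _); rewrite dC => mle.
  apply: le_trans (dT _ (s (maxn N n)).1 _) _.
  by rewrite addrC; apply: lerD; apply: ltW => //; apply: near_s; exact: leq_maxr.
have lP n : d (s n).1 l < (s n).2 /\ ~ closure (F n) l.
  by have [_ _ /(_ l (sl n.+1))] := sP n.
exists l; first by apply: r0U; exact: (lP 0%N).1.
by move=> [n _ Fl]; apply: (lP n).2; exact: subset_closure.
Qed.

(** A cluster point of a Cauchy sequence is its limit. *)
Lemma compact_completely_metrizable (R : realType) (K : metricType R) :
  compact [set: K] -> completely_metrizable R K.
Proof.
move=> cK; exists (@mdist R K); split.
- split; [exact: mdist_ge0| |exact: metric_sym|exact: metric_triangle].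
  by move=> x y; split => [|->]; [exact: mdist_positivity|exact: mdistxx].
- move=> x U; split.
    by move=> /nbhs_ballP[e /= e0]; rewrite ballEmdist; exists e.
  by move=> [e e0 eU]; apply/nbhs_ballP; exists e => //; rewrite ballEmdist.
- move=> u cu.
  have [l [_ clul]] := cK (u @ \oo) _ filterT.
  exists l => U /nbhs_ballP[e /= e0 eU].
  have e20 : 0 < e / 2 by rewrite divr_gt0.
  have [N NP] := cu _ e20.
  have [y [[n Nn <-]]] : (u @` [set n | (N <= n)%N]) `&` ball l (e / 2) !=set0.
    apply: clul; last exact: nbhsx_ballx.
    by exists N => // n /= Nn; exists n.
  rewrite ballEmdist /= => ln; exists N => // m /= Nm.
  apply: eU; rewrite ballEmdist /= (splitr e).
  by apply: le_lt_trans (metric_triangle _ (u n) _) _; apply: ltrD => //; exact: NP.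
Qed.

(** One point is picked in each nonempty set of a countable basis. *)
Lemma compact_dense_sequence (R : realType) (K : metricType R) :
  [set: K] !=set0 -> compact [set: K] ->
  exists v : nat -> K, dense (range v).
Proof.
move=> [k0 _] cK.
(* The second countability of compact spaces needs a pointed type. *)
pose KP : pseudoPMetricType R := HB.pack K (isPointed.Build K k0).
have [B cB [oB bB]] := @compact_second_countable R KP cK.
have /countable_injP[g gI] := cB.
have /choice[v vP] (n : nat) : exists x : K,
    forall V : set K, B V -> g V = n -> V !=set0 -> V x.
  have [[V [BV gV [x Vx]]]|nV] := pselect (exists V : set K,
      [/\ B V, g V = n & V !=set0]).
    exists x => W BW gW _; suff -> : W = V by [].
    by apply: gI; rewrite ?inE// gW gV.
  by exists k0 => W BW gW W0; exfalso; apply: nV; exists W.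
exists v => O [x Ox] oO.
have [V [BV Vx] VO] := bB x _ (open_nbhs_nbhs (conj oO Ox)).
exists (v (g V)); split; last by exists (g V).
by apply/VO/(vP _ V) => //; exists x.
Qed.

(** * Haar meager sets are meager *)

Theorem theorem2p2 (R : realType) (X : topologicalZmodType)
    (hX : polish R X) (A : set X) (hA : haar_meager R A) : meager A.
Proof.
case: hX => _ cX; case: hA => B [bB AB] [K [f [K0 cK cf fB]]].
have [U oU [mBU mUB]] := borel_baire_property bB.
apply: meagerS AB _.
have [U0|/set0P[u Uu]] := eqVneq U set0; first by rewrite U0 setD0 in mBU.
exfalso.
have [v dv] := compact_dense_sequence K0 cK; have [k0 _] := K0.
have [G nG UBG] := mUB.
have csub (a : X) : continuous (fun x : X => a - x).
  move=> x; apply: (@continuous_comp _ _ _ (fun x => (a, x))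
    (fun x : X * X => x.1 - x.2)); last exact: sub_continuous.
  by apply: cvg_pair => /=; [exact: cvg_cst|exact: cvg_id].
have cfsub (x : X) : continuous (fun k : K => f k - x).
  move=> k; apply: (@continuous_comp _ _ _ (fun k => (f k, x))
    (fun x : X * X => x.1 - x.2)); last exact: sub_continuous.
  by apply: cvg_pair => /=; [exact: cf|exact: cvg_cst].
(* [M] collects the translations for which some [f (v m)] meets a closed
   exceptional set; a translation outside [M] is generic enough for [f]. *)
pose M := \bigcup_n \bigcup_m [set x : X | closure (G n) (f (v m) - x)].
have [x Ux nMx] : exists2 x : X, U (f k0 - x) & ~ M x.
  apply: (nonmeager_point (U := [set x | U (f k0 - x)]) cX).
  - by apply: open_comp oU => x _; exact: csub.
  - by exists (f k0 - u) => /=; rewrite subKr.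
  - apply: meager_bigcup => n; apply: meager_bigcup => m.
    apply: meager_nowhere_dense.
    apply: (@nowhere_dense_preimage_involution _ (fun x => f (v m) - x)) => //.
      by move=> y; exact: subKr.
    exact: nowhere_dense_closure.
have mW : meager [set k | U (f k - x)].
  have mP : meager (\bigcup_n [set k | closure (G n) (f k - x)]).
    apply: meager_bigcup => n; apply: meager_nowhere_dense.
    apply: nowhere_dense_avoid_dense dv _.
      by apply: preimage_closed (@closed_closure _ (G n)) => k _; exact: cfsub.
    rewrite -subset0 => k [clk [m _ mk]]; apply: nMx.
    by exists n => //; exists m => //=; rewrite mk.
  apply: meagerS (meagerU (fB x) mP) => k /= Uk.
  have [Bk|nBk] := pselect (B (f k - x)).
    by left; exists (f k - x) => //; rewrite subrK.
  right; have : (U `\` B) (f k - x) by [].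
  by rewrite UBG => -[n _ Gk]; exists n => //; exact: subset_closure.
have [| |k Uk nUk] := nonmeager_point (U := [set k | U (f k - x)])
  (compact_completely_metrizable cK) _ _ mW.
- by apply: open_comp oU => k _; exact: cfsub.
- by exists k0.
- exact: nUk.
Qed.
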